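(* The spectrum of nim numbers of sums of avoidance games on edge geometries of trees is $\{0,1,2,3\}$; that is, the set of all values $\mathrm{nim}(G_1+G_2)$, where each $G_i=\mathrm{DNG}(S_i,W_i)$ is an avoidance game on the edge geometry $(S_i,\mathcal{K}_i)$ of a tree with $W_i\subseteq S_i$ nonempty, equals $\{0,1,2,3\}$.
   Context: The edge geometry of a finite tree $T$ with edge set $S$ is the convex geometry $(S,\mathcal{K})$ where $\mathcal{K}$ consists of the edge sets of connected subgraphs of $T$ (the empty set included). The convex closure operator is $\tau(A)=\bigcap\{K\in\mathcal{K}\mid A\subseteq K\}$ for $A\subseteq S$. Avoidance game $\mathrm{DNG}(S,W)$, for nonempty $W\subseteq S$: two players alternately choose previously unchosen points of $S$, starting from the empty set of chosen points; a player may choose a point only if, with $P$ the set of all jointly chosen points after the move, $W\not\subseteq\tau(P)$. The last player able to move wins. The nim number of a position $P$ of an impartial game is defined recursively by $\mathrm{nim}(P)=\mathrm{mex}\{\mathrm{nim}(Q)\mid Q\in\mathrm{Opt}(P)\}$, where $\mathrm{Opt}(P)$ is the set of positions reachable from $P$ in one legal move and $\mathrm{mex}(A)$ is the smallest nonnegative integer not in $A$; the nim number of a game is that of its starting position. The sum $P+R$ of two games has options $\mathrm{Opt}(P+R)=\{Q+R\mid Q\in\mathrm{Opt}(P)\}\cup\{P+U\mid U\in\mathrm{Opt}(R)\}$. *)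

(* Defs.v *)
From HB Require Import structures.
From mathcomp Require Import all_boot.

Set Implicit Arguments.
Unset Strict Implicit.
Unset Printing Implicit Defensive.

Lemma mex_exists (A : seq nat) : exists n, n \notin A.
Proof.
exists (\max_(i <- A) i).+1; apply/negP => /(@leq_bigmax_seq _ _ xpredT id).
by move=> /(_ isT); rewrite ltnn.
Qed.

Definition mex (A : seq nat) : nat := ex_minn (mex_exists A).

(* An impartial game has finitely many positions; [opt_wf] says that there is
   no infinite play.  A position need not be reachable from [start]. *)
Record game := Game {
  pos : finType;
  opt : pos -> {set pos};
  start : pos;
  opt_wf : well_founded (fun Q P : pos => Q \in opt P)
}.

Definition nim_pos (G : game) : pos G -> nat :=
  Fix (@opt_wf G) (fun=> nat)
    (fun P rec => mex [seq rec (val Q) (valP Q) | Q : {Q | Q \in opt P}]).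

Lemma eq_mex (A B : seq nat) : A =i B -> mex A = mex B.
Proof. by move=> eqAB; apply: eq_ex_minn => n; rewrite eqAB. Qed.

Lemma nim_posE (G : game) (P : pos G) :
  nim_pos P = mex [seq nim_pos Q | Q in opt P].
Proof.
rewrite /nim_pos Fix_eq => [|{}P f g eq_fg]; last first.
  by congr mex; apply: eq_map => Q; apply: eq_fg.
apply: eq_mex => n; apply/imageP/imageP => [[Q _ ->]|[Q QP ->]].
  by exists (val Q) => //; apply: valP.
by exists (exist _ Q QP).
Qed.

Definition nim (G : game) : nat := nim_pos (start G).

Definition sum_opt (G H : game) (p : pos G * pos H) : {set pos G * pos H} :=
  [set (Q, p.2) | Q in opt p.1] :|: [set (p.1, U) | U in opt p.2].

Lemma sum_opt_wf (G H : game) :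
  well_founded (fun q p : pos G * pos H => q \in sum_opt p).
Proof.
case=> P R; elim/(well_founded_ind (@opt_wf G)): P R => P IHP.
elim/(well_founded_ind (@opt_wf H)) => R IHR.
constructor=> _ /setUP[] /imsetP[Q Qopt ->]; first exact: IHP.
exact: IHR.
Qed.

Definition sum_game (G H : game) : game :=
  @Game _ (@sum_opt G H) (start G, start H) (@sum_opt_wf G H).

(* [S] is the ground set inside the ambient type [E], and [K] the family of
   convex subsets of [S]; [hull K A] is the closure of [A] when [A] is a
   subset of [S] and [S] belongs to [K], as it does in a convex geometry. *)
Definition hull (E : finType) (K : {set {set E}}) (A : {set E}) : {set E} :=
  \bigcap_(C in K | A \subset C) C.

Definition DNG_opt (E : finType) (S : {set E}) (K : {set {set E}})
    (W P : {set E}) : {set {set E}} :=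
  [set x |: P | x in S :\: P & ~~ (W \subset hull K (x |: P))].

Lemma DNG_opt_wf (E : finType) (S : {set E}) (K : {set {set E}})
  (W : {set E}) :
  well_founded (fun Q P : {set E} => Q \in DNG_opt S K W P).
Proof.
move=> P; have [n] := ubnP #|~: P|; elim: n P => [P|n IHn P]; first by rewrite ltn0.
rewrite ltnS => lePn.
constructor=> _ /imsetP[x + ->]; rewrite !inE => /andP[/andP[xP _] _].
apply: IHn; apply: leq_trans lePn; apply: proper_card.
by rewrite properE !setCS subsetUr subUset sub1set (negPf xP).
Qed.

Definition DNG (E : finType) (S : {set E}) (K : {set {set E}})
  (W : {set E}) : game :=
  @Game _ (DNG_opt S K W) set0 (@DNG_opt_wf E S K W).

(* [ucycle adj c] says that the vertices of [c] are distinct and cyclically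
   adjacent; this holds of [:: x; y] for every edge xy, so a cycle of the
   graph is such a [c] with at least three vertices. *)
Record tree := Tree {
  vertex :> finType;
  adj : rel vertex;
  adj_sym : symmetric adj;
  adj_irr : irreflexive adj;
  tree_nonempty : 0 < #|vertex|;
  tree_connected : forall x y : vertex, connect adj x y;
  tree_acyclic : forall c : seq vertex, ucycle adj c -> size c <= 2
}.

Definition edges (T : tree) : {set {set T}} :=
  [set [set p.1; p.2] | p : T * T & adj p.1 p.2].

(* Edges are 2-element vertex sets, and a subgraph is a pair of a vertex set
   [X] and an edge set [F].  [X] may be empty or a singleton, so the empty edge
   set is convex. *)
Definition is_subgraph (T : tree) (X : {set T}) (F : {set {set T}}) : bool :=
  (F \subset edges T) && [forall e in F, e \subset X].

Definition is_connected (T : tree) (X : {set T}) (F : {set {set T}}) : bool :=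
  [forall x in X, forall y in X, connect [rel u v | [set u; v] \in F] x y].

Definition edge_convex (T : tree) : {set {set {set T}}} :=
  [set F | [exists X : {set T}, is_subgraph X F && is_connected X F]].

Definition edge_DNG (T : tree) (W : {set {set T}}) : game :=
  DNG (edges T) (edge_convex T) W.

(* Main.v *)
Require Import Defs.
From mathcomp Require Import all_boot.
From mathcomp Require Import zify.
From Stdlib Require Import PeanoNat.

Set Implicit Arguments.
Unset Strict Implicit.
Unset Printing Implicit Defensive.

(** By the Sprague-Grundy theorem ([nim_pos_sum]) the nim number of a sum is
    the bitwise exclusive or of the nim numbers of the summands.  It is
    therefore enough that a single avoidance game on the edges of a tree has
    nim number at most 3 ([nim_edge_DNG_le3]) and that 0, 1 and 2 occur
    ([path3_spectrum]), since 3 is the exclusive or of 2 and 1.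

    Upper bound.  Call the maximal legal positions facets: a position is legal
    when some facet contains it.  Deleting an edge [w] from a tree leaves two
    half-trees, and a convex set that misses [w] lies in one of them, so every
    facet is the edge set of a half-tree cut off by an edge of [W].  For two
    edges, the half-tree of the first that is turned away from the second,
    together with the first edge, lies in a half-tree of the second
    ([half_nested]).  Since no facet contains another one, it follows that an
    edge outside two different facets is outside all of them
    ([halves_facet_split]).

    Consequently a legal move from [P] either stays inside all facets around
    [P] or leaves exactly one of them.  Count the facets [M] around [P]
    according to the parity of [#|M :\: P|].  A move exchanges the roles of the
    two parities and removes at most one facet, and as long as two facets
    remain each of them can be left by some move.  Hence ([nim_legal]) the nim
    number is 0 when the even facets are in the majority and 1 when the odd
    ones are.  In a tie, leaving an odd or an even facet gives the values 0 and
    1, so that the number of remaining points common to all facets decides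
    between 2 and 3.

    Realisation.  On the path with three edges a, b, c in this order, the sets
    W = {a}, {b}, {a, b} have the facets {b, c}; {a}, {c}; and {b, c}, {a},
    which give the values 0, 1 and 2. *)

(** * Nim numbers of sums *)

Section Nim.
Variable G : game.
Implicit Types P Q : pos G.

Lemma nim_opt_neq P Q : Q \in opt P -> nim_pos Q <> nim_pos P.
Proof.
move=> QP eqQP; have: nim_pos Q \in [seq nim_pos R | R in opt P] by exact: image_f.
rewrite eqQP nim_posE /mex.
by case: ex_minnP => m /negP.
Qed.

Lemma lt_nim_opt P k : k < nim_pos P -> exists2 Q, Q \in opt P & nim_pos Q = k.
Proof.
rewrite nim_posE /mex; case: ex_minnP => m _ minm lt_km.
have: k \in [seq nim_pos Q | Q in opt P].
  by apply: contraLR lt_km => /minm; rewrite -leqNgt.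
by case/imageP=> Q QP ->; exists Q.
Qed.

Lemma nim_posP P n :
    (forall Q, Q \in opt P -> nim_pos Q <> n) ->
    (forall k, k < n -> exists2 Q, Q \in opt P & nim_pos Q = k) ->
  nim_pos P = n.
Proof.
move=> not_n below; case: (ltngtP (nim_pos P) n) => //.
  by case/below => Q /nim_opt_neq.
by case/lt_nim_opt => Q /not_n.
Qed.

End Nim.

Lemma testbit_bool_double k (z : bool) m : Nat.testbit (z + k.*2) m =
    if m is m'.+1 then Nat.testbit k m' else z.
Proof.
have -> : z + k.*2 = Nat.add (Nat.mul 2 k) (Nat.b2n z).
  by rewrite addnC -muln2 mulnC; case: z.
case: m => [|m]; [exact (Nat.testbit_0_r k z) | exact (Nat.testbit_succ_r k z m)].
Qed.

Lemma lxor_double_bit (a b : nat) (x y : bool) :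
  Nat.lxor (x + a.*2) (y + b.*2) = (x (+) y) + (Nat.lxor a b).*2.
Proof.
apply: Nat.bits_inj => m; rewrite Nat.lxor_spec !testbit_bool_double.
by case: m => [|m]; [case: x; case: y | rewrite Nat.lxor_spec].
Qed.

(** The arithmetic core of the Sprague-Grundy theorem: any value below the
    exclusive or is reached by lowering one of the two arguments.  If the
    halves of [k] and of [Nat.lxor a b] differ, halving reduces the claim to
    itself.  Otherwise they differ only in the lowest bit, and the argument
    whose lowest bit is 1 can be lowered. *)
Lemma lt_lxor a b k : k < Nat.lxor a b -> Nat.lxor k b < a \/ Nat.lxor k a < b.
Proof.
have lt_bit (x y : bool) (c d : nat) :
    (x + c.*2 < y + d.*2) = (c < d) || [&& c == d, ~~ x & y].
  by case: x; case: y => /=; lia.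
have step (x y z : bool) (c d e : nat) :
      (e < Nat.lxor c d -> Nat.lxor e d < c \/ Nat.lxor e c < d) ->
      z + e.*2 < Nat.lxor (x + c.*2) (y + d.*2) ->
    Nat.lxor (z + e.*2) (y + d.*2) < x + c.*2 \/
    Nat.lxor (z + e.*2) (x + c.*2) < y + d.*2.
  rewrite !lxor_double_bit !lt_bit => IH /orP[/IH[->|->]|]; [by left|by right|].
  case/and3P=> /eqP-> /negPf-> /=.
  rewrite Nat.lxor_assoc Nat.lxor_nilpotent Nat.lxor_0_r (Nat.lxor_comm c).
  rewrite Nat.lxor_assoc Nat.lxor_nilpotent Nat.lxor_0_r !eqxx.
  by case: x; case: y => //= _; [left|right]; rewrite orbT.
have [n] := ubnP (a + b); elim: n k a b => // n IHn k a b lt_ab_n lt_k.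
have lt_half_n : a./2 + b./2 < n.
  have : (a, b) != (0, 0) by apply: contraTneq lt_k => -[-> ->].
  by rewrite xpair_eqE; lia.
move: lt_k; rewrite -[a]odd_double_half -[b]odd_double_half -[k]odd_double_half.
exact/step/IHn.
Qed.

(** An option changes one of the two arguments, and the exclusive or is
    injective in each of them, so no option has the value of the position;
    [lt_lxor] provides the smaller values. *)
Lemma nim_pos_sum (G H : game) (P : pos G) (R : pos H) :
  @nim_pos (sum_game G H) (P, R) = Nat.lxor (nim_pos P) (nim_pos R).
Proof.
have lxor_injl a b c : Nat.lxor a c = Nat.lxor b c -> a = b.
  move=> /(congr1 (Nat.lxor^~ c)).
  by rewrite !Nat.lxor_assoc Nat.lxor_nilpotent !Nat.lxor_0_r.
move: P R; have IH := well_founded_ind (@sum_opt_wf G H).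
suff: forall p : pos (sum_game G H),
    nim_pos p = Nat.lxor (nim_pos p.1) (nim_pos p.2) by move=> + P R => ->.
elim/IH=> -[P R] {}IH /=.
apply: nim_posP => [_ /setUP[] /imsetP[Q Qopt ->]|k /lt_lxor[] /lt_nim_opt[Q Qopt nimQ]].
- rewrite IH ?inE ?imset_f //= => /lxor_injl; exact: nim_opt_neq.
- rewrite IH ?inE ?imset_f ?orbT //= Nat.lxor_comm [RHS]Nat.lxor_comm.
  move/lxor_injl; exact: nim_opt_neq.
- exists (Q, R); rewrite ?IH ?inE ?imset_f //= nimQ.
  by rewrite Nat.lxor_assoc Nat.lxor_nilpotent Nat.lxor_0_r.
exists (P, Q); rewrite ?IH ?inE ?imset_f ?orbT //= nimQ Nat.lxor_comm.
by rewrite Nat.lxor_assoc Nat.lxor_nilpotent Nat.lxor_0_r.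
Qed.

(** * Avoidance games and their facets *)

Section Avoidance.
Variables (E : finType) (S : {set E}) (K : {set {set E}}) (W : {set E}).
Implicit Types (x w : E) (P Q C M A B : {set E}).

Definition legal P := ~~ (W \subset hull K P).

Lemma legalP P :
  reflect (exists w C, [/\ w \in W, C \in K, w \notin C & P \subset C]) (legal P).
Proof.
apply: (iffP subsetPn) => [[w wW]|[w [C [wW CK wC sPC]]]].
  rewrite /hull -in_setC setC_bigcap => /bigcupP[C /andP[CK sPC]].
  by rewrite inE => wC; exists w, C.
by exists w => //; apply: contra wC => /bigcapP; apply; rewrite CK.
Qed.

Lemma legal_sub P Q : P \subset Q -> legal Q -> legal P.
Proof.
move=> sPQ /legalP[w [C [wW CK wC sQC]]]; apply/legalP; exists w, C.
by split=> //; apply: subset_trans sQC.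
Qed.

Lemma DNG_optP P Q :
  reflect (exists x, [/\ x \in S, x \notin P, legal (x |: P) & Q = x |: P])
          (Q \in DNG_opt S K W P).
Proof.
apply: (iffP imsetP) => [[x]|[x [xS xP leg ->]]].
  by rewrite !inE => /andP[/andP[xP xS] leg] ->; exists x.
by exists x; rewrite ?inE ?xP ?xS.
Qed.

(** Closure is monotone, so that no move leads from an illegal position back
    to a legal one. *)
Lemma nim_illegal P : ~~ legal P -> @nim_pos (DNG S K W) P = 0.
Proof.
move=> illP; apply: nim_posP => // Q /DNG_optP[x [_ _ leg _]].
by case/negP: illP; apply: legal_sub leg; apply: subsetUr.
Qed.

Definition facets := [set M | maxset legal M].

Lemma facet_legal M : M \in facets -> legal M.
Proof. by rewrite inE => /maxsetP[]. Qed.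

Lemma facet_sub M P : M \in facets -> legal P -> M \subset P -> M = P.
Proof. by rewrite inE => /maxsetP[_ maxM] legP /(maxM _ legP). Qed.

Lemma facet_above P : legal P -> exists2 M, M \in facets & P \subset M.
Proof. by case/maxset_exists=> M maxM sPM; exists M; rewrite ?inE. Qed.

Definition star P := [set M in facets | P \subset M].

Lemma in_star P M : (M \in star P) = (M \in facets) && (P \subset M).
Proof. by rewrite in_set. Qed.

(** Once [M] is the only facet around [P], the play lasts exactly
    [#|M :\: P|] more moves and its parity decides the game. *)
Definition parity_count b P := #|[set M in star P | odd #|M :\: P| == b]|.

Definition core P := (\bigcap_(M in star P) M) :\: P.

Definition DNG_value P :=
  if parity_count true P < parity_count false P then 0
  else if parity_count false P < parity_count true P then 1
  else 2 + odd #|core P|.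

Lemma card_star P : #|star P| = parity_count true P + parity_count false P.
Proof.
rewrite -(cardsID [set M : {set E} | odd #|M :\: P|] (star P)).
congr (_ + _); apply: eq_card => M; rewrite !inE ?eqb_id ?eqbF_neg //.
by rewrite andbC.
Qed.

Lemma odd_move x P M : x \in M -> x \notin P ->
  odd #|M :\: (x |: P)| = ~~ odd #|M :\: P|.
Proof.
move=> xM xP; rewrite (cardsD1 x (M :\: P)) !inE xM xP /= negbK.
by congr (odd _); apply: eq_card => y; rewrite !inE negb_or andbA.
Qed.

Lemma star_move x P : star (x |: P) = [set M in star P | x \in M].
Proof.
by apply/setP => M; rewrite !inE subUset sub1set andbA [RHS]andbAC.
Qed.

Definition stays x P := [forall M in star P, x \in M].

Definition drops x P M :=
  [&& M \in star P, x \notin M & [forall N in star P, (x \notin N) ==> (N == M)]].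

Lemma parity_count_stay x P b : x \notin P -> stays x P ->
  parity_count b (x |: P) = parity_count (~~ b) P.
Proof.
move=> xP /forall_inP stay; apply: eq_card => M; rewrite star_move !inE -!andbA.
apply: andb_id2l => MF; apply: andb_id2l => sPM.
have xM : x \in M by apply: stay; rewrite !inE MF.
by rewrite xM odd_move //; case: odd; case: b.
Qed.

Lemma core_stay x P : x \notin P -> stays x P -> core P = x |: core (x |: P).
Proof.
move=> xP /forall_inP stay; rewrite /core; have -> : star (x |: P) = star P.
  by apply/setP=> M; rewrite star_move inE andb_idr //; apply: stay.
have xcore : x \in \bigcap_(M in star P) M by apply/bigcapP.
apply/setP=> y; rewrite in_setU1 !in_setD in_setU1.
by case: eqP => [->|]; rewrite ?xP.
Qed.

Lemma odd_core_stay x P : x \notin P -> stays x P ->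
  odd #|core P| = ~~ odd #|core (x |: P)|.
Proof. by move=> xP /core_stay-> //; rewrite cardsU1 !inE eqxx. Qed.

(** Leaving the facet [M] removes it from the count of its own parity; the
    parities of the other facets around [P] are exchanged, since they contain
    the chosen point. *)
Lemma parity_count_drop x P M b : x \notin P -> drops x P M ->
  parity_count b P = (odd #|M :\: P| == b) + parity_count (~~ b) (x |: P).
Proof.
move=> xP /and3P[MP xM /forall_inP dropM].
rewrite /parity_count star_move (cardsD1 M).
move: (star P) MP dropM => Z MZ dropM; congr (_ + _); first by rewrite inE MZ.
apply: eq_card => N; rewrite !inE; case NZ: (N \in Z); last by rewrite andbF.
have /implyP := dropM N NZ; case: (boolP (x \in N)) => [xN _|_ /(_ isT)->//].
rewrite odd_move //; case: eqP => [eqNM|_]; first by rewrite -eqNM xN in xM.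
by case: odd; case: (b).
Qed.

Hypothesis sub_S : forall C, C \in K -> C \subset S.

(** A point lies in all facets, in all facets but one, or in no facet. *)
Hypothesis facet_split : forall x M1 M2 M,
  M1 \in facets -> M2 \in facets -> M \in facets -> M1 != M2 ->
  x \notin M1 -> x \notin M2 -> x \notin M.

Lemma facet_subS M : M \in facets -> M \subset S.
Proof.
by move/facet_legal/legalP=> [w [C [_ /sub_S sCS _ sMC]]]; apply: subset_trans sCS.
Qed.

Lemma move_cases x P : legal (x |: P) -> stays x P \/ exists M, drops x P M.
Proof.
case/facet_above=> M1 FM1; rewrite subUset sub1set => /andP[xM1 sPM1].
have [|/forall_inPn[M MP xM]] := boolP (stays x P); [by left | right].
exists M; apply/and3P; split=> //; apply/forall_inP => N NP; apply/implyP=> xN.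
have [//|neqNM] := eqVneq N M.
move: NP MP; rewrite !in_star => /andP[FN _] /andP[FM _].
by rewrite (negPf (facet_split FN FM FM1 neqNM xN xM)) in xM1.
Qed.

(** Facets are pairwise incomparable, so a second facet [N] around [P] has a
    point outside [M].  Choosing it is legal because [N] survives, and by
    [facet_split] no facet other than [M] is lost. *)
Lemma drop_move P M : M \in star P -> 1 < #|star P| ->
  exists x, [/\ x \in S, x \notin P, legal (x |: P) & drops x P M].
Proof.
move=> MP; rewrite (cardsD1 M) MP add1n ltnS => /card_gt0P[N].
rewrite in_setD1 in_star => /and3P[neqNM FN sPN]; move: (MP).
rewrite in_star => /andP[FM sPM].
have /subsetPn[x xN xM] : ~~ (N \subset M).
  by apply: contra neqNM => /(facet_sub FN (facet_legal FM))->.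
exists x; split.
- exact: subsetP (facet_subS FN) x xN.
- by apply: contra xM; apply: subsetP.
- by apply: legal_sub (facet_legal FN); rewrite subUset sub1set xN.
apply/and3P; split=> //; apply/forall_inP => L; rewrite in_star => /andP[FL _].
apply/implyP=> xL; apply: contraTT xN => neqLM.
exact: facet_split neqLM xL xM.
Qed.

(** Induction on the position.  When one parity has the majority, no move leads
    to a position of the same value: after a move the majority has changed
    sides or there is a tie.  When the odd facets have the majority, a position
    of value 0 is reached by leaving an even facet, or an odd one if no even
    one is left, or, inside a single facet, by any move.  In a tie, leaving an
    even facet gives value 0, leaving an odd one gives value 1, and staying in
    all facets keeps the tie and shrinks the core by one point. *)
Lemma nim_legal P : legal P -> @nim_pos (DNG S K W) P = DNG_value P.
Proof.
elim/(well_founded_ind (@DNG_opt_wf E S K W)): P => P IH legP.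
have {}IH x : x \in S -> x \notin P -> legal (x |: P) ->
    @nim_pos (DNG S K W) (x |: P) = DNG_value (x |: P).
  by move=> xS xP legxP; apply: IH => //; apply/DNG_optP; exists x.
have opt_move x k : x \in S -> x \notin P -> legal (x |: P) ->
    DNG_value (x |: P) = k ->
    exists2 Q, Q \in @opt (DNG S K W) P & nim_pos Q = k.
  move=> xS xP legxP <-; exists (x |: P); last exact: IH.
  by apply/DNG_optP; exists x.
have star_gt0 : 0 < #|star P|.
  have [M FM sPM] := facet_above legP.
  by apply/card_gt0P; exists M; rewrite in_star FM.
have drop_parity b : 1 < #|star P| -> 0 < parity_count b P ->
    exists x, [/\ x \in S, x \notin P, legal (x |: P),
      parity_count b P = (parity_count (~~ b) (x |: P)).+1
      & parity_count (~~ b) P = parity_count b (x |: P)].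
  move=> star_gt1 /card_gt0P[M]; rewrite inE => /andP[MP /eqP oddM].
  have [x [xS xP legxP dropM]] := drop_move MP star_gt1.
  exists x; rewrite !(parity_count_drop _ xP dropM) oddM eqxx negbK.
  by split=> //; case: (b).
have stay_core x : x \in core P -> [/\ x \in S, x \notin P, legal (x |: P) & stays x P].
  rewrite inE => /andP[xP /bigcapP xcore].
  have [M FM sPM] := facet_above legP; have MP : M \in star P by rewrite in_star FM.
  have xM := xcore M MP.
  split=> //; last exact/forall_inP.
    exact: subsetP (facet_subS FM) _ xM.
  by apply: legal_sub (facet_legal FM); rewrite subUset sub1set xM.
rewrite card_star in star_gt0 drop_parity.
apply: nim_posP => [_ /DNG_optP[x [xS xP legxP ->]]|k].
  rewrite IH // /DNG_value.
  have [stay|[M dropM]] := move_cases legxP.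
    rewrite !parity_count_stay // (odd_core_stay xP stay) /=.
    by case: (ltngtP (parity_count true P)) => // _; case: odd.
  rewrite !(parity_count_drop _ xP dropM) /=.
  by case: (odd #|M :\: P|) => /=; do !case: ifP => ?; lia.
rewrite {1}/DNG_value; case: (ltngtP (parity_count true P)) => // [gt_oe|eq_eo].
- case: k => // _.
  have [star_gt1|star_le1] := ltnP 1 (parity_count true P + parity_count false P).
    (* Leaving an even facet is preferred: it keeps the odd ones in the majority,
       and these become even.  If all facets are odd, there is one to spare. *)
    have [e0|e_gt0] := posnP (parity_count false P).
      have [|x [xS xP legxP eqo eqe]] := drop_parity true star_gt1; first lia.
      rewrite /= in eqo eqe; apply: (opt_move x) => //.
      by rewrite /DNG_value; case: ifP => //; lia.
    have [x [xS xP legxP eqe eqo]] := drop_parity false star_gt1 e_gt0.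
    rewrite /= in eqo eqe; apply: (opt_move x) => //.
    by rewrite /DNG_value; case: ifP => //; lia.
  (* A single odd facet is left, and all its remaining points are in the core. *)
  have /card_gt0P[M] : 0 < parity_count true P by exact: leq_ltn_trans gt_oe.
  rewrite in_set => /andP[MP /eqP oddM].
  have /card_gt0P[x] : 0 < #|M :\: P| by apply: odd_gt0.
  rewrite in_setD => /andP[xP xM].
  rewrite -card_star in star_le1.
  have [|xS _ legxP stay] := stay_core x.
    rewrite in_setD xP; apply/bigcapP => N NP.
    by rewrite (card_le1_eqP star_le1 M N).
  apply: (opt_move x) => //; rewrite /DNG_value !parity_count_stay //=.
  by rewrite gt_oe.
have star_gt1 : 1 < parity_count true P + parity_count false P by lia.
case: k => [_|[_|k lt_k]].
- have [|x [xS xP legxP eqe eqo]] := drop_parity false star_gt1; first by lia.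
  rewrite /= in eqo eqe; apply: (opt_move x) => //.
  by rewrite /DNG_value; case: ifP => //; lia.
- have [|x [xS xP legxP eqo eqe]] := drop_parity true star_gt1; first by lia.
  rewrite /= in eqo eqe; apply: (opt_move x) => //.
  rewrite /DNG_value ifF; last by lia.
  by rewrite ifT //; lia.
have odd_core : odd #|core P| by case: odd lt_k.
have /card_gt0P[x xcore] : 0 < #|core P| by apply: odd_gt0.
have [xS xP legxP stay] := stay_core x xcore.
apply: (opt_move x) => //; rewrite /DNG_value !parity_count_stay //= eq_eo ltnn.
by move: lt_k; rewrite (odd_core_stay xP stay) in odd_core *; case: odd odd_core; case: k.
Qed.

Lemma nim_DNG_le3 P : @nim_pos (DNG S K W) P <= 3.
Proof.
have [/nim_legal->|/nim_illegal->//] := boolP (legal P).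
by rewrite /DNG_value; do 2!case: ifP => // _; case: odd.
Qed.

End Avoidance.

Section TwoFacets.
Variables (E : finType) (S : {set E}) (K : {set {set E}}) (W M1 M2 : {set E}).
Hypothesis sub_S : forall C, C \in K -> C \subset S.
Hypothesis facet_split : forall x N1 N2 N,
  N1 \in facets K W -> N2 \in facets K W -> N \in facets K W -> N1 != N2 ->
  x \notin N1 -> x \notin N2 -> x \notin N.
Hypothesis legalE : forall P, legal K W P = (P \subset M1) || (P \subset M2).
Hypothesis M12 : M1 \subset M2 -> M1 = M2.
Hypothesis M21 : M2 \subset M1 -> M1 = M2.

(** The value of the starting position when the facets are [M1] and [M2];
    [M1 = M2] is the case of a single facet. *)
Lemma nim_two_facets :
  nim (DNG S K W) =
    if odd #|M1| == odd #|M2| then nat_of_bool (odd #|M1|)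
    else 2 + odd #|M1 :&: M2|.
Proof.
have facets2 : facets K W = [set M1; M2].
  apply/setP=> M; rewrite !inE; apply/maxsetP/orP => [[legM maxM]|].
    have leg1 : legal K W M1 by rewrite legalE subxx.
    have leg2 : legal K W M2 by rewrite legalE subxx orbT.
    by move: legM; rewrite legalE => /orP[/(maxM _ leg1)->|/(maxM _ leg2)->]; [left|right].
  have max1 (P : {set E}) : (P \subset M1) || (P \subset M2) -> M1 \subset P -> P = M1.
    move=> + sM1P; case/orP=> sP; first by apply/eqP; rewrite eqEsubset sP.
    by apply/eqP; rewrite eqEsubset sM1P (M12 (subset_trans sM1P sP)) sP.
  have max2 (P : {set E}) : (P \subset M1) || (P \subset M2) -> M2 \subset P -> P = M2.
    move=> + sM2P; case/orP=> sP; last by apply/eqP; rewrite eqEsubset sP.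
    by apply/eqP; rewrite eqEsubset sM2P -(M21 (subset_trans sM2P sP)) sP.
  case=> /eqP->; rewrite legalE subxx ?orbT; split=> // P; rewrite legalE; auto.
have star0 : star K W set0 = [set M1; M2].
  by rewrite -facets2; apply/setP=> M; rewrite in_star sub0set andbT.
rewrite /nim (nim_legal sub_S facet_split) ?legalE ?sub0set //.
have count0 b : parity_count K W b set0 = #|[set M in [set M1; M2] | odd #|M| == b]|.
  by rewrite /parity_count star0; apply: eq_card => M; rewrite !inE setD0.
rewrite /DNG_value /core star0 bigcap_setU !big_set1 setD0 !count0.
case: eqP => [eq12|neq12].
  have count_pos : 0 < #|[set M in [set M1; M2] | odd #|M| == odd #|M1|]|.
    by apply/card_gt0P; exists M1; rewrite !inE !eqxx.
  have count_zero : #|[set M in [set M1; M2] | odd #|M| == ~~ odd #|M1|]| = 0.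
    apply: eq_card0 => M; rewrite !inE; apply/negP=> /andP[] /orP[]/eqP->.
      by case: odd.
    by rewrite -eq12; case: odd.
  case: odd count_pos count_zero => /= + ->; first by move->.
  by move->.
have count1 b : #|[set M in [set M1; M2] | odd #|M| == b]| = 1.
  apply/eqP/cards1P; have [eq1|neq1] := eqVneq (odd #|M1|) b.
    exists M1; apply/setP=> M; rewrite !inE.
    have [->|_] := eqVneq M M1; first by rewrite eq1 eqxx.
    by case: eqP => //= ->; apply/eqP=> eq2; rewrite eq1 eq2 in neq12.
  exists M2; apply/setP=> M; rewrite !inE.
  have [->|_] := eqVneq M M2; last first.
    by rewrite orbF; case: eqP => //= ->; apply: negPf.
  by rewrite orbT; move: neq12 neq1; case: odd; case: odd; case: b.
by rewrite !count1.
Qed.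

End TwoFacets.

(** * Convex geometries with half-spaces *)

Section Halves.
Variables (E : finType) (S : {set E}) (K : {set {set E}}).
Implicit Types (x w : E) (W A B C M : {set E}).

(** The two half-spaces cut off by [w].  In a tree these are the edge sets of
    the two components left by deleting [w]; each of them remains convex when
    [w] is added. *)
Definition halves w A B :=
  [/\ [/\ A \in K, w |: A \in K & w \notin A],
      [/\ B \in K, w |: B \in K & w \notin B],
      S = w |: (A :|: B), [disjoint A & B]
    & forall C, C \in K -> w \notin C -> C \subset A \/ C \subset B].

Lemma halves_sym w A B : halves w A B -> halves w B A.
Proof.
case=> hA hB defS disAB cover; split=> //; first by rewrite (setUC B).
  by rewrite disjoint_sym.
by move=> C CK /(cover C CK)[]; [right | left].
Qed.

(** The set [w1 |: A1] is convex, misses [w2] and contains the point [w1] of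
    [A2], hence lies in the half [A2]. *)
Lemma half_nested w1 w2 A1 B1 A2 B2 :
    halves w1 A1 B1 -> halves w2 A2 B2 -> w1 \in A2 -> w2 \in B1 ->
  w1 |: A1 \subset A2.
Proof.
case=> [[_ wA1K _] [_ _ w1B1] _ dis1 _] [_ _ _ dis2 cover2] w1A2 w2B1.
have w2A1 : w2 \notin w1 |: A1.
  rewrite in_setU1 negb_or (disjointFl dis1 w2B1) andbT.
  by apply: contraNneq w1B1 => <-.
have [//|/subsetP/(_ w1 (setU11 _ _))] := cover2 _ wA1K w2A1.
by rewrite (disjointFr dis2 w1A2).
Qed.

Lemma half_cases w1 w2 A B : halves w1 A B -> w2 \in S -> w2 != w1 ->
  (w2 \in A) || (w2 \in B).
Proof. by case=> _ _ -> _ _; rewrite !inE => /orP[/eqP->|->]; rewrite ?eqxx ?orbT. Qed.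

Hypothesis S_halves : forall w, w \in S -> exists A B, halves w A B.

Variable W : {set E}.
Hypothesis sub_W : W \subset S.

Local Notation facets := (facets K W).
Local Notation legal := (legal K W).

Lemma half_legal w A B : w \in W -> halves w A B -> legal A.
Proof. by move=> wW [[AK _ wA] _ _ _ _]; apply/legalP; exists w, A. Qed.

Lemma facet_half M : M \in facets -> exists w B, w \in W /\ halves w M B.
Proof.
move=> FM; have /legalP[w [C [wW CK wC sMC]]] := facet_legal FM.
have [A [B hAB]] := S_halves (subsetP sub_W w wW).
have [_ _ _ _ /(_ C CK wC) cover] := hAB.
case: cover => /(subset_trans sMC) sM; exists w.
  by exists B; rewrite (facet_sub FM (half_legal wW hAB) sM).
have hBA := halves_sym hAB.
by exists A; rewrite (facet_sub FM (half_legal wW hBA) sM).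
Qed.

(** Let [M1] and [M2] be cut off by [w1] and [w2].  If [w1 = w2] they are its
    two halves, so that [x = w1]; a facet containing [w1] would by [half_nested]
    contain one of these halves properly.  If [w1] and [w2] differ, then unless
    [w1] is in [M2] and [w2] is in [M1], [half_nested] puts [M1] or [M2]
    properly into a legal set.  In the remaining case [M1] and [M2] together
    cover all of [S]. *)
Lemma halves_facet_split x M1 M2 M :
  M1 \in facets -> M2 \in facets -> M \in facets -> M1 != M2 ->
  x \notin M1 -> x \notin M2 -> x \notin M.
Proof.
move=> FM1 FM2 FM neqM xM1 xM2; apply/negP => xM.
have no_facet_inside w N (P : {set E}) :
    N \in facets -> w \notin N -> w |: N \subset P -> ~ legal P.
  move=> FN wN; rewrite subUset sub1set => /andP[wP sNP] legP.
  by rewrite (facet_sub FN legP sNP) wP in wN.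
have [w1 [B1 [w1W h1]]] := facet_half FM1.
have [w2 [B2 [w2W h2]]] := facet_half FM2.
have [w [B [wW h]]] := facet_half FM.
have xS : x \in S by have [_ _ -> _ _] := h; rewrite !inE xM orbT.
have w1S := subsetP sub_W _ w1W; have w2S := subsetP sub_W _ w2W.
have wS := subsetP sub_W _ wW.
have [[_ _ w1M1] [_ _ w1B1] _ _ cover1] := h1.
have [[M2K _ w2M2] _ _ _ _] := h2.
have [eqw|neqw] := eqVneq w1 w2.
  rewrite -{}eqw in h2 w2M2.
  have defB1 : M2 = B1.
    have [s21|s2B] := cover1 M2 M2K w2M2.
      by case/eqP: neqM; rewrite (facet_sub FM2 (facet_legal FM1) s21).
    exact: facet_sub FM2 (half_legal w1W (halves_sym h1)) s2B.
  have eqx : x = w1.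
    by apply/eqP/contraT => /(half_cases h1 xS); rewrite -defB1 (negPf xM1) (negPf xM2).
  have neqww1 : w != w1.
    by have [[_ _ wM] _ _ _ _] := h; apply: contraNneq wM => ->; rewrite -eqx.
  rewrite eqx in xM.
  have /orP[wM1|wB1] := half_cases h1 wS neqww1.
    apply: (no_facet_inside w1 M2 M) => //; last exact: facet_legal.
    by rewrite defB1; apply: half_nested (halves_sym h1) h xM wM1.
  apply: (no_facet_inside w1 M1 M) => //; last exact: facet_legal.
  exact: half_nested h1 h xM wB1.
have neqw' : w2 != w1 by rewrite eq_sym.
have /orP[w2M1|w2B1] := half_cases h1 w2S neqw';
  have /orP[w1M2|w1B2] := half_cases h2 w1S neqw.
- have /subsetP sB1 := half_nested (halves_sym h1) h2 w1M2 w2M1.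
  have [_ _ defS _ _] := h1; move: xS.
  rewrite defS setUCA in_setU (negPf xM1) => /sB1.
  by rewrite (negPf xM2).
- apply: (no_facet_inside w2 M2 M1) => //; last exact: facet_legal.
  exact: half_nested h2 h1 w2M1 w1B2.
- apply: (no_facet_inside w1 M1 M2) => //; last exact: facet_legal.
  exact: half_nested h1 h2 w1M2 w2B1.
apply: (no_facet_inside w1 M1 B2) => //; last exact: half_legal (halves_sym h2).
exact: half_nested h1 (halves_sym h2) w1B2 w2B1.
Qed.

End Halves.

(** * Edge geometries of trees *)

Section Tree.
Variable T : tree.
Implicit Types (u v x y z : T) (e w : {set T}) (C F : {set {set T}}).

Lemma edgeP e :
  reflect (exists x y, adj x y /\ e = [set x; y]) (e \in edges T).
Proof.
apply: (iffP imsetP) => [[[x y]]|[x [y [xy ->]]]]; last by exists (x, y); rewrite ?inE.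
by rewrite inE => xy ->; exists x, y.
Qed.

Lemma adj_edge x y : ([set x; y] \in edges T) = adj x y.
Proof.
apply/edgeP/idP => [[x' [y' [xy' eqxy]]]|]; last by exists x, y.
have neq' : x' != y' by apply: contraTneq xy' => ->; rewrite adj_irr.
have := set21 x y; rewrite eqxy !inE; have := set22 x y; rewrite eqxy !inE.
move=> /orP[]/eqP defy /orP[]/eqP defx; rewrite defx defy // ?(adj_sym y') //.
  by have := set22 x' y'; rewrite -eqxy defx defy setUid inE eq_sym (negPf neq').
by have := set21 x' y'; rewrite -eqxy defx defy setUid inE (negPf neq').
Qed.

Definition link F := [rel x y : T | [set x; y] \in F].

Lemma link_sym F : connect_sym (link F).
Proof. by apply: sym_connect_sym => x y /=; rewrite setUC. Qed.

Lemma edge_convexI z (X : {set T}) F :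
    F \subset edges T -> (forall e, e \in F -> e \subset X) ->
    (forall x, x \in X -> connect (link F) z x) ->
  F \in edge_convex T.
Proof.
move=> sFE sFX cX; rewrite inE; apply/existsP; exists X.
rewrite /is_subgraph sFE; apply/andP; split; first exact/forall_inP.
apply/forall_inP => x xX; apply/forall_inP => y yX.
by apply: connect_trans (cX y yX); rewrite link_sym cX.
Qed.

Lemma edge_convex_sub C : C \in edge_convex T -> C \subset edges T.
Proof. by rewrite inE => /existsP[X /andP[/andP[]]]. Qed.

Lemma edge_convex_connect C e1 e2 x y : C \in edge_convex T ->
  e1 \in C -> e2 \in C -> x \in e1 -> y \in e2 -> connect (link C) x y.
Proof.
rewrite inE => /existsP[X /andP[/andP[_ /forall_inP sCX] /forall_inP cX]].
move=> /sCX/subsetP s1 /sCX/subsetP s2 /s1 xX /s2 yX.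
exact: (forall_inP (cX x xX)).
Qed.

Lemma edge_convex_star z F :
  F \subset edges T -> (forall e, e \in F -> z \in e) -> F \in edge_convex T.
Proof.
move=> sFE zF; apply: (@edge_convexI z (z |: cover F)) => // [e Fe|x].
  exact: subset_trans (bigcup_sup e Fe) (subsetUr _ _).
case/setU1P=> [-> //|/bigcupP[e Fe xe]].
have [->//|neqxz] := eqVneq x z; apply: connect1 => /=.
have /edgeP[p [q [_ defe]]] := subsetP sFE e Fe.
suff -> : [set z; x] = e by [].
move: (zF e Fe) xe neqxz; rewrite {}defe !inE.
by case/orP=> /eqP-> /orP[]/eqP->; rewrite ?eqxx // setUC.
Qed.

(** The half-tree on the side of [u] after the edge [w] has been deleted. *)
Definition side w u : {set {set T}} :=
  [set e in edges T | e \subset [set x | connect (link (edges T :\ w)) u x]].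

(** A path from [u] that avoids [w] never leaves the component of [u], so all
    its edges are in [side w u]. *)
Lemma link_side w u x : connect (link (edges T :\ w)) u x -> connect (link (side w u)) u x.
Proof.
pose U := connect (link (edges T :\ w)) u.
pose Z := [pred y | U y && connect (link (side w u)) u y].
move=> cux; suff: x \in Z by case/andP.
have closedZ : closed (link (edges T :\ w)) Z; last first.
  by rewrite -(closed_connect closedZ cux) inE /U !connect0.
apply: (intro_closed (link_sym _)) => y z yz; rewrite !inE => /andP[uy suy].
have uz := connect_trans uy (connect1 yz).
rewrite /U uz (connect_trans suy (connect1 _)) //=.
move: yz => /setD1P[_ yzE].
by rewrite in_set yzE subUset !sub1set !in_set uz andbT.
Qed.

Lemma side_edge_convex w u : side w u \in edge_convex T.
Proof.
apply: (@edge_convexI u [set x | connect (link (edges T :\ w)) u x]).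
- by apply/subsetP => e; rewrite inE => /andP[].
- by move=> e; rewrite inE => /andP[].
by move=> x; rewrite inE; apply: link_side.
Qed.

Lemma side_add_edge_convex u v : adj u v ->
  [set u; v] |: side [set u; v] u \in edge_convex T.
Proof.
move=> uv; set w := [set u; v]; set U := [set x | connect (link (edges T :\ w)) u x].
have subF : subrel (link (side w u)) (link (w |: side w u)).
  by move=> x y /= xy; rewrite in_setU1 xy orbT.
apply: (@edge_convexI u (v |: U)).
- rewrite subUset sub1set adj_edge uv.
  by apply/subsetP => e; rewrite inE => /andP[].
- move=> e /setU1P[->|]; last by rewrite inE => /andP[_ /subset_trans->]; rewrite ?subsetUr.
  by rewrite subUset !sub1set !inE eqxx connect0 orbT.
move=> x /setU1P[->|]; first by apply: connect1; rewrite /= setU11.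
rewrite inE => /link_side; apply: connect_sub => y z yz.
exact/connect1/subF.
Qed.

(** A path from [u] to [v] that avoids the edge joining them would close up
    with this edge to a cycle. *)
Lemma bridge u v : adj u v -> ~~ connect (link (edges T :\ [set u; v])) u v.
Proof.
move=> uv; apply/negP => /connectP[p0 /shortenP[p up uniq_p _] defv].
have adj_p : path (@adj T) u p.
  by apply: sub_path up => x y /setD1P[_]; rewrite adj_edge.
have : ucycle (@adj T) (u :: p).
  by rewrite /ucycle uniq_p andbT /= rcons_path adj_p -defv adj_sym.
move/tree_acyclic; case: p defv up {adj_p uniq_p} => [eq_vu|x []//= <-].
  by rewrite eq_vu adj_irr in uv.
by rewrite in_setD1 eqxx.
Qed.

(** The edges of [C] are linked within [C], hence without using the deleted
    edge, so they lie on the same side as any one of them. *)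
Lemma side_cases u v C : adj u v -> C \in edge_convex T ->
  [set u; v] \notin C -> C \subset side [set u; v] u \/ C \subset side [set u; v] v.
Proof.
move=> uv CK; set w := [set u; v] => wC; set G := link (edges T :\ w).
have [->|[e Ce]] := set_0Vmem C; first by left; apply: sub0set.
have subCG : subrel (connect (link C)) (connect G).
  apply: connect_sub => x y xy; apply: connect1; rewrite /= in_setD1.
  rewrite (subsetP (edge_convex_sub CK) _ xy) andbT.
  by apply: contraNneq wC => <-.
have side_of s x : connect G s x -> x \in e -> C \subset side w s.
  move=> sx xe; apply/subsetP => f Cf.
  rewrite inE (subsetP (edge_convex_sub CK)) //; apply/subsetP => y yf.
  by rewrite inE (connect_trans sx) // subCG // (edge_convex_connect CK Ce Cf).
have [x [y [_ defe]]] := edgeP _ (subsetP (edge_convex_sub CK) e Ce).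
have xe : x \in e by rewrite defe set21.
suff: connect G u x || connect G v x.
  by case/orP=> /side_of/(_ xe); [left | right].
have := tree_connected u x; pose Z := [pred x | connect G u x || connect G v x].
have closedZ : closed (@adj T) Z; last first.
  by move/(closed_connect closedZ); rewrite !inE connect0.
apply: (intro_closed (sym_connect_sym (@adj_sym T))) => p q pq; rewrite !inE.
have [eqw|neqw] := eqVneq [set p; q] w.
  by have := set22 p q; rewrite eqw => /set2P[]->; rewrite connect0 ?orbT.
have pqG : connect G p q by apply: connect1; rewrite /= in_setD1 neqw adj_edge.
by case/orP=> /connect_trans->; rewrite ?orbT.
Qed.

Lemma edge_halves w : w \in edges T ->
  exists A B, halves (edges T) (edge_convex T) w A B.
Proof.
case/edgeP=> u [v [uv]] ->{w}; set w := [set u; v].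
have vu : adj v u by rewrite adj_sym.
have neg x y : adj x y -> [set x; y] \notin side [set x; y] x.
  move=> xy; rewrite in_set subUset !sub1set !in_set.
  by rewrite (negPf (bridge xy)) !andbF.
have sub_side x : side w x \subset edges T.
  by apply/subsetP => e; rewrite inE => /andP[].
exists (side w u), (side w v); split.
- by split; [exact: side_edge_convex | exact: side_add_edge_convex | exact: neg].
- rewrite [w]setUC.
  by split; [exact: side_edge_convex | exact: side_add_edge_convex | exact: neg].
- apply/eqP; rewrite eqEsubset !subUset sub1set adj_edge uv !sub_side /= andbT.
  apply/subsetP => e eE; rewrite !in_setU in_set1.
  have [//|neqew] := eqVneq e w.
  have [x [y [_ defe]]] := edgeP _ eE.
  have eK : [set e] \in edge_convex T.
    apply: (@edge_convex_star x); first by rewrite sub1set.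
    by move=> f /set1P->; rewrite defe set21.
  have [||] := side_cases uv eK; rewrite ?sub1set ?inE ?(eq_sym _ e) //.
    by move=> ->.
  by move=> ->; rewrite orbT.
- apply/pred0Pn => -[e /andP[]] /=; rewrite !in_set.
  case/andP=> /edgeP[x [y [_ ->]]]; rewrite !subUset !sub1set !in_set.
  case/andP=> ux _ /and3P[_ vx _]; case/negP: (bridge uv).
  by apply: connect_trans ux _; rewrite link_sym.
by move=> C CK; apply: side_cases.
Qed.

End Tree.

Lemma nim_edge_DNG_le3 (T : tree) (W : {set {set T}}) (P : pos (edge_DNG W)) :
  W \subset edges T -> nim_pos P <= 3.
Proof.
move=> sWE; apply: nim_DNG_le3; first exact: edge_convex_sub.
by move=> x M1 M2 M; apply: (halves_facet_split (@edge_halves T) sWE).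
Qed.

(** * The path with three edges *)

Definition path_adj n (i j : 'I_n.+1) : bool := (i.+1 == j :> nat) || (j.+1 == i :> nat).

Lemma path_adj_sym n : symmetric (@path_adj n).
Proof. by move=> i j; apply: orbC. Qed.

Lemma path_adj_irr n : irreflexive (@path_adj n).
Proof. by move=> i; rewrite /path_adj orbb; apply: gtn_eqF. Qed.

Lemma path_nonempty n : 0 < #|'I_n.+1|.
Proof. by rewrite card_ord. Qed.

Lemma path_connected n (i j : 'I_n.+1) : connect (@path_adj n) i j.
Proof.
have sym := sym_connect_sym (@path_adj_sym n).
have from0 k (lt_kn : k < n.+1) : connect (@path_adj n) ord0 (Ordinal lt_kn).
  elim: k lt_kn => [|k IHk] lt_kn; first by rewrite (_ : Ordinal _ = ord0) //; apply: val_inj.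
  by apply: connect_trans (IHk (ltnW lt_kn)) (connect1 _); rewrite /path_adj eqxx.
case: i j => i lt_in [j lt_jn].
by apply: connect_trans (from0 j lt_jn); rewrite sym.
Qed.

(** The largest vertex of a cycle with at least three vertices would have two
    different smaller neighbours. *)
Lemma path_acyclic n (c : seq 'I_n.+1) : ucycle (@path_adj n) c -> size c <= 2.
Proof.
case: c => // i0 c0; set c := i0 :: c0 => cyc.
have [m cm max_m] : exists2 m, m \in c & forall i, i \in c -> i <= m.
  case: (@arg_maxnP _ i0 (mem c) val) => [|m cm maxm]; first exact: mem_head.
  by exists m.
have [k p defc] := rot_to cm; rewrite -(size_rot k c) defc.
have le_m i : i \in m :: p -> i <= m by rewrite -defc mem_rot; apply: max_m.
move: cyc; rewrite /ucycle -(rot_cycle k) -(rot_uniq k) defc.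
case: p le_m {defc} => // i p; case: (lastP p) => // {}p j le_m.
rewrite /= rcons_path last_rcons /path_adj /= mem_rcons inE negb_or.
have /le_m le_im : i \in m :: i :: rcons p j by rewrite !inE eqxx orbT.
have /le_m le_jm : j \in m :: i :: rcons p j by rewrite !inE mem_rcons !inE eqxx !orbT.
case/andP=> /andP[mi /andP[_ jm]] /and3P[_ /andP[/eqP neq_ij _] _].
case: neq_ij; apply: val_inj => /=; move: mi jm le_im le_jm.
lia.
Qed.

Definition path_tree n : tree :=
  Tree (@path_adj_sym n) (@path_adj_irr n) (@path_nonempty n) (@path_connected n)
    (@path_acyclic n).

Section ThreeEdgePath.
Let T : tree := path_tree 3.
Let v0 : T := @Ordinal 4 0 isT.
Let v1 : T := @Ordinal 4 1 isT.
Let v2 : T := @Ordinal 4 2 isT.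
Let v3 : T := @Ordinal 4 3 isT.
Let a : {set T} := [set v0; v1].
Let b : {set T} := [set v1; v2].
Let c : {set T} := [set v2; v3].

Lemma path3_edges : edges T = [set a; b; c].
Proof.
apply/eqP; rewrite eqEsubset andbC !subUset !sub1set !adj_edge /=.
apply/subsetP => e /(@edgeP T)[x [y [xy ->]]]; rewrite !inE.
wlog {xy} xy : x y / x.+1 = y :> nat.
  move=> IH; case/orP: xy => /eqP; first exact: IH.
  by rewrite setUC; apply: IH.
have eq_edge (p q : T) : x = p :> nat -> q = p.+1 :> nat -> [set x; y] = [set p; q].
  by move=> xp qp; congr [set _; _]; apply: val_inj; rewrite //= -xy xp.
have : x < 3 by have := ltn_ord y; rewrite -xy.
case def_x: (x : nat) => [|[|[|]]] // _.
- by rewrite (eq_edge v0 v1) ?eqxx.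
- by rewrite (eq_edge v1 v2) ?eqxx ?orbT.
by rewrite (eq_edge v2 v3) ?eqxx ?orbT.
Qed.

Lemma path3_neq : [/\ a != b, a != c & b != c].
Proof.
split; apply/eqP; first by move/setP/(_ v0); rewrite !inE.
  by move/setP/(_ v0); rewrite !inE.
by move/setP/(_ v1); rewrite !inE.
Qed.

Let K := edge_convex T.

Lemma path3_convex : [/\ [set a] \in K, [set c] \in K & [set b; c] \in K].
Proof.
split.
- apply: (@edge_convex_star T v0) => [|e /set1P->]; last exact: set21.
  by rewrite path3_edges sub1set !inE eqxx.
- apply: (@edge_convex_star T v2) => [|e /set1P->]; last exact: set21.
  by rewrite path3_edges sub1set !inE eqxx orbT.
apply: (@edge_convex_star T v2) => [|e /set2P[]->]; rewrite ?set21 ?set22 //.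
by rewrite path3_edges -setUA subsetUr.
Qed.

Lemma path3_avoid_a C : C \in K -> a \notin C -> C \subset [set b; c].
Proof.
move=> /edge_convex_sub sCE aC; apply/subsetP => e Ce.
have := subsetP sCE e Ce; rewrite path3_edges !inE -orbA => /or3P[/eqP eqa||->].
- by rewrite -eqa Ce in aC.
- by move->.
by rewrite orbT.
Qed.

(** The edges a and c are on different sides of b. *)
Lemma path3_avoid_b C : C \in K -> b \notin C ->
  (C \subset [set a]) || (C \subset [set c]).
Proof.
have b12 : adj v1 v2 by [].
have b21 : adj v2 v1 by [].
move=> CK bC; have := side_cases b12 CK bC; rewrite -/b.
case=> sC; apply/orP; [left | right].
  apply: subset_trans sC _; apply/subsetP => e; rewrite in_set => /andP[].
  rewrite {1}path3_edges in_set1 !in_setU !in_set1 -orbA => /or3P[->//||] /eqP->;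
    by rewrite subUset !sub1set !in_set (negPf (bridge b12)) ?andbF.
apply: subset_trans sC _; apply/subsetP => e; rewrite in_set => /andP[].
have /negPf nb := bridge b21; rewrite [[set v2; v1]]setUC -/b in nb.
rewrite {1}path3_edges in_set1 !in_setU !in_set1 -orbA => /or3P[||->//] /eqP->;
  by rewrite subUset !sub1set !in_set nb ?andbF.
Qed.

Lemma path3_legal_a P : legal K [set a] P = (P \subset [set b; c]).
Proof.
have [ab ac bc] := path3_neq; have [aK cK bcK] := path3_convex.
apply/legalP/idP => [[w [C [/set1P-> CK aC sPC]]]|sP].
  exact: subset_trans sPC (path3_avoid_a CK aC).
by exists a, [set b; c]; split; rewrite ?set11 ?set21 ?set22 // !inE ?negb_or ab.
Qed.

Lemma path3_legal_b P :
  legal K [set b] P = (P \subset [set a]) || (P \subset [set c]).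
Proof.
have [ab ac bc] := path3_neq; have [aK cK bcK] := path3_convex.
apply/legalP/orP => [[w [C [/set1P-> CK bC sPC]]]|[] sP].
- by case/orP: (path3_avoid_b CK bC) => /(subset_trans sPC); [left|right].
- by exists b, [set a]; split; rewrite ?set11 ?set21 ?set22 // !inE ?negb_or 1?eq_sym ab.
by exists b, [set c]; split; rewrite ?set11 ?set21 ?set22 // !inE ?negb_or bc.
Qed.

Lemma path3_legal_ab P :
  legal K [set a; b] P = (P \subset [set b; c]) || (P \subset [set a]).
Proof.
have [ab ac bc] := path3_neq; have [aK cK bcK] := path3_convex.
apply/legalP/orP => [[w [C [/set2P[]-> CK wC sPC]]]|[] sP].
- by left; apply: subset_trans sPC (path3_avoid_a CK wC).
- case/orP: (path3_avoid_b CK wC) => /(subset_trans sPC) sP; [by right|left].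
  exact: subset_trans sP (subsetUr _ _).
- by exists a, [set b; c]; split; rewrite ?set11 ?set21 ?set22 // !inE ?negb_or ab.
by exists b, [set a]; split; rewrite ?set11 ?set21 ?set22 // !inE ?negb_or 1?eq_sym ab.
Qed.

Lemma path3_spectrum n : n < 3 -> exists W : {set {set T}},
  [/\ W \subset edges T, W != set0 & nim (edge_DNG W) = n].
Proof.
have [ab ac bc] := path3_neq.
have sub1E e : e \in edges T -> [set e] \subset edges T by rewrite sub1set.
have neq1 (e : {set T}) : [set e] != set0 by apply/set0Pn; exists e; rewrite set11.
have [aE bE cE] : [/\ a \in edges T, b \in edges T & c \in edges T].
  by rewrite path3_edges !inE !eqxx !orbT.
have value (W M1 M2 : {set {set T}}) (sWE : W \subset edges T) :=
  @nim_two_facets _ _ K W M1 M2 (@edge_convex_sub T)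
    (halves_facet_split (@edge_halves T) sWE).
case: n => [|[|[|//]]] _.
- have sWE := sub1E a aE; exists [set a]; split; rewrite /edge_DNG //.
  by rewrite (value _ [set b; c] [set b; c] sWE) ?cards2 ?bc // => P;
    rewrite path3_legal_a orbb.
- have sWE := sub1E b bE; exists [set b]; split; rewrite /edge_DNG //.
  rewrite (value _ [set a] [set c] sWE path3_legal_b) ?cards1 //;
    by rewrite sub1set => /set1P->.
have sWE : [set a; b] \subset edges T by rewrite subUset !sub1E.
exists [set a; b]; split; rewrite /edge_DNG //.
  by apply/set0Pn; exists a; rewrite set21.
rewrite (value _ [set b; c] [set a] sWE path3_legal_ab) ?cards1 ?cards2 ?bc //=.
- rewrite (_ : _ :&: _ = set0) ?cards0 //; apply/eqP; rewrite setI_eq0.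
  by rewrite disjoint_sym disjoints1 !inE negb_or ab.
- by rewrite subUset !sub1set !inE [b == a]eq_sym (negPf ab).
by rewrite sub1set !inE (negPf ab) (negPf ac).
Qed.

End ThreeEdgePath.

(** * The spectrum of sums *)

Theorem theorem41 :
  forall n : nat,
    (exists (T1 T2 : tree) (W1 : {set {set T1}}) (W2 : {set {set T2}}),
        [/\ W1 \subset edges T1, W1 != set0,
            W2 \subset edges T2, W2 != set0
          & nim (sum_game (edge_DNG W1) (edge_DNG W2)) = n])
    <-> n \in [:: 0; 1; 2; 3].
Proof.
move=> n; split=> [[T1 [T2 [W1 [W2 [sW1 _ sW2 _ <-]]]]]|n4].
  rewrite /nim nim_pos_sum.
  have := nim_edge_DNG_le3 (start (edge_DNG W1)) sW1.
  have := nim_edge_DNG_le3 (start (edge_DNG W2)) sW2.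
  move: (nim_pos _) (nim_pos _).
  by do 2![case=> [|[|[|[|?]]]] //].
have [x [y [x3 y3 <-]]] : exists x y, [/\ x < 3, y < 3 & Nat.lxor x y = n].
  (* Only 3 needs two nonzero summands: it is the exclusive or of 2 and 1. *)
  by move: n4; rewrite !inE => /or4P[]/eqP->;
    [exists 0, 0 | exists 1, 0 | exists 2, 0 | exists 2, 1].
have [W1 [sW1 neW1 nimW1]] := path3_spectrum x3.
have [W2 [sW2 neW2 nimW2]] := path3_spectrum y3.
exists (path_tree 3), (path_tree 3), W1, W2; split=> //.
by rewrite -nimW1 -nimW2 /nim nim_pos_sum.
Qed.
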